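(* Let $H$ be a real separable Hilbert space, $T>0$, and let $F\colon H\to\mathcal{P}(H)$ be bcc and Hausdorff-continuous. Let $(u_n)_{n}$ be a sequence in $C([0,T];H)$ converging (uniformly) to $u\in C([0,T];H)$. Then for every $\varepsilon>0$ there exists $n_0\in\mathbb{N}$ such that for all $n\ge n_0$ and all $f\in \mathrm{Sel}\,F(u)$ there exists $f_n\in \mathrm{Sel}\,F(u_n)$ with $$\|f_n-f\|_{L^2(0,T;H)}\le \varepsilon .$$
   Context: $\mathcal{P}(H)$ is the power set of $H$. A map $F\colon H\to\mathcal{P}(H)$ is called bcc if for every $x\in H$ the set $F(x)$ is nonempty, bounded, closed and convex. The Hausdorff distance of $A,B\subseteq H$ is $d_{\mathrm{Hd}}(A,B)=\max\{\sup_{a\in A}\inf_{b\in B}\|a-b\|,\ \sup_{b\in B}\inf_{a\in A}\|a-b\|\}$. A bcc map $F$ is Hausdorff-continuous if it is continuous from $(H,\|\cdot\|)$ to the set of nonempty bounded closed subsets of $H$ equipped with $d_{\mathrm{Hd}}$. For $u\colon[0,T]\to H$, $F(u)$ denotes $F\circ u\colon [0,T]\to\mathcal{P}(H)$, and $\mathrm{Sel}\,F(u)$ is the set of all measurable functions $f\colon[0,T]\to H$ with $f(t)\in F(u(t))$ for almost every $t\in[0,T]$. *)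

(* Defs.v *)
From HB Require Import structures.
From mathcomp Require Import all_boot all_order all_algebra.
From mathcomp Require Import all_classical all_reals all_analysis.

Set Implicit Arguments.
Unset Strict Implicit.
Unset Printing Implicit Defensive.
Import Order.TTheory GRing.Theory Num.Theory.
Import numFieldNormedType.Exports.
Local Open Scope classical_set_scope.
Local Open Scope ring_scope.

(* A real Hilbert space is a complete normed module over [R] together with an
   inner product [dot] (a positive definite symmetric form) inducing its norm. *)
Definition induces_norm (R : realType) (H : normedModType R)
    (dot : {dot H for (@idfun R)}) : Prop :=
  forall x : H, `|x| = Num.sqrt (dot x x).

Definition separable (X : topologicalType) : Prop :=
  exists2 D : set X, countable D & dense D.

Definition bcc (R : realType) (H : normedModType R) (F : H -> set H) : Prop :=
  forall x, [/\ F x !=set0, bounded_set (F x), closed (F x) &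
    convex_set (F x : set (convex_lmodType H))].

(* Extended-real valued, so that no boundedness or nonemptiness is built in;
   it is finite on nonempty bounded sets. *)
Definition hausdorff_dist (R : realType) (H : normedModType R) (A B : set H) :
    \bar R :=
  maxe (ereal_sup [set ereal_inf [set `|a - b|%:E | b in B] | a in A])
       (ereal_sup [set ereal_inf [set `|a - b|%:E | a in A] | b in B]).

Definition hausdorff_continuous (R : realType) (H : normedModType R)
    (F : H -> set H) : Prop :=
  forall (x : H) (e : R), 0 < e ->
    \forall y \near x, (hausdorff_dist (F x) (F y) < e%:E)%E.

(* The real line with the sigma-algebra of Lebesgue (i.e. Caratheodory)
   measurable sets, on which [completed_lebesgue_measure] is defined. *)
Definition lebesgueTypeR (R : realType) :=
  caratheodory_type (@wlength R idfun)^*%mu.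

Definition borelType (X : ptopologicalType) := g_sigma_algebraType (@open X).

(* Measurable selections on [0, T], as functions on the whole line of which
   only the restriction to [0, T] matters. *)
Definition Sel (R : realType) (H : completeNormedModType R) (T : R)
    (F : H -> set H) (u : R -> H) : set (R -> H) :=
  [set f | measurable_fun (`[0, T] : set (lebesgueTypeR R))
             (f : lebesgueTypeR R -> borelType H) /\
           {ae (@completed_lebesgue_measure R),
             forall t, (0 <= t <= T)%R -> F (u t) (f t)} ].

(* The L^2(0, T; H) norm, equal to +oo when [g] is not square-integrable. *)
Definition L2norm (R : realType) (H : normedModType R) (T : R) (g : R -> H) :
    \bar R :=
  'N[@completed_lebesgue_measure R]_(2%:E)[
    (fun t => `|g t|%:E) \_ `[0%R, T] ].

(* Main.v *)
(** For [t] in [[0, T]] let [fn t] be the metric projection of [f t] onto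
    [F (u_ n t)]. By compactness of [[0, T]] and Hausdorff continuity of [F], the
    distance of [F (u t)] to [F (u_ n t)] is below [eps / sqrt T] uniformly in
    [t] for large [n], hence so is [`|fn t - f t|] whenever [f t] is in
    [F (u t)]. The projection onto [F v] depends jointly continuously on [v] and
    on the projected point, by the parallelogram identity, so [fn] is measurable
    because [H] is separable. *)
Require Import Defs.
From HB Require Import structures.
From mathcomp Require Import all_boot all_order all_algebra.
From mathcomp Require Import all_classical all_reals all_analysis.
From mathcomp Require Import ring lra.
Import Order.TTheory GRing.Theory Num.Theory.
Import numFieldNormedType.Exports.
Local Open Scope classical_set_scope.
Local Open Scope ring_scope.

(** * Metric projection onto closed convex sets *)

Lemma parallelogram {R : realType} {H : normedModType R}
    {dot : {dot H for (@idfun R)}} (dotH : induces_norm dot) (x y : H) :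
  `|x + y| ^+ 2 + `|x - y| ^+ 2 = 2 * `|x| ^+ 2 + 2 * `|y| ^+ 2.
Proof.
have dot_ge0 z : 0 <= dot z z.
  have [->|z0] := eqVneq z 0; first by rewrite linear0l.
  exact/ltW/neq0_dnorm_gt0.
have sqE z : `|z| ^+ 2 = dot z z by rewrite dotH sqr_sqrtr.
have dotD a b : dot (a + b) (a + b) = dot a a + dot a b + (dot b a + dot b b).
  by rewrite linearDl !linearDr.
by rewrite !sqE !dotD !linearNl !linearNr; ring.
Qed.

(** The midpoint of [a] and [b] stays in [C], hence at distance at least [d] from [x]; the
    parallelogram identity then bounds [|a - b|^2] by [4 (d + r)^2 - 4 d^2]. As [r] depends only on
    [d] and [e], the lemma serves both existence and continuity of projections. *)
Lemma near_minimizers_close {R : realType} {H : normedModType R}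
    {dot : {dot H for (@idfun R)}} (dotH : induces_norm dot) (d e : R) :
  0 <= d -> 0 < e -> exists2 r : R, 0 < r &
  forall (C : set H) (x a b : H), convex_set (C : set (convex_lmodType H)) ->
    (forall c, C c -> d <= `|x - c|) -> C a -> C b ->
    `|x - a| <= d + r -> `|x - b| <= d + r -> `|a - b| < e.
Proof.
move=> d0 e0; have e20 : 0 < e ^+ 2 by rewrite exprn_gt0.
have q0 : 0 < 8 * (2 * d + 1) :> R by lra.
(* With [r <= 1], [8 d r + 4 r^2 <= 4 r (2 d + 1) <= e^2 / 2], which leaves room for the strict
   inequality. *)
pose r := Num.min 1 (e ^+ 2 / (8 * (2 * d + 1))).
have r0 : 0 < r by rewrite lt_min ltr01 divr_gt0.
exists r => // C x a b convC dC Ca Cb xa xb.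
have r1 : r <= 1 by rewrite ge_min lexx.
have rq : r * (8 * (2 * d + 1)) <= e ^+ 2.
  by rewrite -ler_pdivlMr// ge_min lexx orbT.
pose m : H := 2^-1 *: a + 2^-1 *: b.
have Cm : C m.
  have h0 : 0 <= (2^-1 : R) <= 1 by lra.
  have := convC a b (Itv01 (proj1 (andP h0)) (proj2 (andP h0))).
  rewrite !inE => /(_ Ca Cb); congr (C (_ + _ *: _)).
  by rewrite /= /unstable.onem; lra.
have /dC xm := Cm.
have := parallelogram dotH (x - a) (x - b).
have -> : x - a + (x - b) = 2%:R *: (x - m).
  rewrite /m scalerBr scalerDr !scalerA mulfV ?pnatr_eq0// !scale1r scaler_nat.
  by rewrite mulr2n opprD addrACA.
have -> : x - a - (x - b) = - (a - b) by rewrite opprB addrC addrA subrK opprB.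
rewrite normrN normrZ ger0_norm// => E.
rewrite -(@ltr_pXn2r _ 2)// ?nnegrE//; last exact: ltW.
have xa2 : `|x - a| ^+ 2 <= (d + r) ^+ 2.
  by rewrite ler_pXn2r ?nnegrE ?addr_ge0// ltW.
have xb2 : `|x - b| ^+ 2 <= (d + r) ^+ 2.
  by rewrite ler_pXn2r ?nnegrE ?addr_ge0// ltW.
have xm2 : d ^+ 2 <= `|x - m| ^+ 2 by rewrite ler_pXn2r ?nnegrE.
rewrite exprMn in E.
nra.
Qed.

(** The default 0 is returned only when no nearest point exists. *)
Definition proj {R : realType} {H : normedModType R} (C : set H) (x : H) : H :=
  xget 0 [set a | C a /\ forall c, C c -> `|x - a| <= `|x - c|].

(** The sets [B r] of points of [C] whose distance to [x] exceeds the infimum by at most [r]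
    generate a filter, Cauchy by [near_minimizers_close]. Its limit is in [C] by closedness and
    attains the infimum. *)
Lemma projP {R : realType} {H : completeNormedModType R}
    {dot : {dot H for (@idfun R)}} (dotH : induces_norm dot)
    (C : set H) (x : H) :
  C !=set0 -> closed C -> convex_set (C : set (convex_lmodType H)) ->
  C (proj C x) /\ forall c, C c -> `|x - proj C x| <= `|x - c|.
Proof.
move=> [c0 Cc0] clC convC; rewrite /proj; case: xgetP => // /(_ _) noproj.
exfalso.
pose N := [set `|x - c| | c in C].
have infN : has_inf N by split; [exists `|x - c0|, c0|exists 0 => _ [c _ <-]].
have dC c : C c -> inf N <= `|x - c|.
  by move=> Cc; apply: ge_inf; [case: infN|exists c].
have d0 : 0 <= inf N by apply: lb_le_inf; [case: infN|move=> _ [c _ <-]].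
pose B r := C `&` [set c | `|x - c| <= inf N + r].
pose G : set_system H := filter_from [set r : R | 0 < r] B.
have FG : ProperFilter G.
  apply: filter_from_proper => [|r /= r0].
    apply: filter_from_filter; first by exists 1 => /=.
    move=> r s /= r0 s0; exists (Num.min r s) => /=; first by rewrite lt_min r0.
    by move=> c [Cc]; rewrite /= addr_minr le_min => /andP[].
  have [_ [c Cc <-] /ltW cr] := inf_adherent r0 infN.
  by exists c.
have GB r : 0 < r -> G (B r) by exists r.
have : cauchy_ex G.
  move=> e e0; have [r r0 close] := near_minimizers_close dotH _ _ d0 e0.
  have [a [Ca ar]] : B r !=set0.
    exact/(@filter_ex _ G)/GB.
  exists a, r => // b [Cb br]; rewrite -ball_normE /=.
  exact: (close C x).
move=> /cauchy_exP /cauchy_cvg /cvg_ex[p Gp].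
apply: (noproj p); split.
  apply: (@closed_cvg _ _ G FG id C clC _ p Gp).
  by apply: filterS (GB 1 ltr01) => c [].
move=> c Cc; apply: le_trans (dC c Cc); apply/ler_addgt0Pr => e e0.
have cl : closed [set y : H | `|x - y| <= inf N + e].
  apply: (@preimage_closed _ _ (fun y : H => `|x - y|) [set z | z <= inf N + e]).
    move=> y _; apply: (@continuous_comp _ _ _ (fun y => x - y) Num.norm).
      by apply: cvgB; [exact: cvg_cst|exact: cvg_id].
    exact: norm_continuous.
  exact: closed_le.
by apply: (@closed_cvg _ _ G FG id _ cl _ p Gp); apply: filterS (GB e e0) => b [].
Qed.

(** * Hausdorff distance and continuity of the projection *)

Lemma hausdorff_dist_ltl {R : realType} {H : normedModType R} (A B : set H)
    (e : R) (a : H) : (hausdorff_dist A B < e%:E)%E -> A a ->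
  exists2 b, B b & `|a - b| < e.
Proof.
move=> + Aa; rewrite /hausdorff_dist gt_max => /andP[+ _].
move=> /(le_lt_trans (ereal_sup_ubound _)).
move=> /(_ (ereal_inf [set `|a - b|%:E | b in B])) /=.
by case/(_ _)/ereal_inf_lt => [|_ [b Bb <-]]; [exists a|rewrite lte_fin; exists b].
Qed.

Lemma hausdorff_dist_ltr {R : realType} {H : normedModType R} (A B : set H)
    (e : R) (b : H) : (hausdorff_dist A B < e%:E)%E -> B b ->
  exists2 a, A a & `|a - b| < e.
Proof.
move=> + Bb; rewrite /hausdorff_dist gt_max => /andP[_ +].
move=> /(le_lt_trans (ereal_sup_ubound _)).
move=> /(_ (ereal_inf [set `|a - b|%:E | a in A])) /=.
by case/(_ _)/ereal_inf_lt => [|_ [a Aa <-]]; [exists b|rewrite lte_fin; exists a].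
Qed.

(** A point [a] of [F v] close to the projection [q] of [y] onto [F w] nearly minimizes the distance
    to [x] over [F v], so it is close to the projection [p] of [x]; hence [q] is close to [p]. *)
Lemma proj_continuous {R : realType} {H : completeNormedModType R}
    {dot : {dot H for (@idfun R)}} (dotH : induces_norm dot)
    (F : H -> set H) : bcc F -> hausdorff_continuous F ->
  continuous (fun z : H * H => proj (F z.1) z.2).
Proof.
move=> bccF contF [v x]; apply/cvgrPdist_lt => e e0 /=.
have projF w y := let: And4 Fn _ Fcl Fcv := bccF w in
  projP dotH _ y Fn Fcl Fcv.
have [Fp pmin] := projF v x; set p := proj (F v) x in Fp pmin *.
have e2 : 0 < e / 2 by rewrite divr_gt0.
have [r r0 close] := near_minimizers_close dotH _ _ (normr_ge0 (x - p)) e2.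
(* Passing from [|x - p|] to [|x - a|] costs four errors below [s]: [|x - y|] twice, [|p - b|] and
   [|a - q|]. The bound [e / 2] controls [|a - q|] in the last line. *)
pose s := Num.min (r / 4) (e / 2).
have s0 : 0 < s by rewrite lt_min e2 divr_gt0.
have sr : s <= r / 4 by rewrite ge_min lexx.
have se : s <= e / 2 by rewrite ge_min lexx orbT.
exists ([set w | (hausdorff_dist (F v) (F w) < s%:E)%E], ball x s).
  by split; [exact: contF|exact: nbhsx_ballx].
move=> [w y] [/= Fvw]; rewrite -ball_normE /= => xy.
have [Fq qmin] := projF w y; set q := proj (F w) y in Fq qmin *.
have [a Fa aq] := hausdorff_dist_ltr _ _ _ _ Fvw Fq.
have [b Fb pb] := hausdorff_dist_ltl _ _ _ _ Fvw Fp.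
have [_ _ _ Fcv] := bccF v.
have pa : `|p - a| < e / 2.
  apply: (close (F v) x) => //; first by rewrite lerDl ltW.
  have := qmin b Fb; have := ler_distD y x a; have := ler_distD q y a.
  have := ler_distD x y b; have := ler_distD p x b.
  rewrite (distrC y x) (distrC q a); lra.
have := ler_distD a p q; lra.
Qed.

Lemma measurable_comp2 {d} {aT : measurableType d} {R : realType}
    {X : normedModType R} {Y : ptopologicalType} (D : set aT) (f g : aT -> X)
    (h : X * X -> Y) : separable X ->
  measurable_fun D (f : aT -> borelType X) ->
  measurable_fun D (g : aT -> borelType X) ->
  continuous h -> measurable_fun D (fun t => h (f t, g t) : borelType Y).
Proof.
move=> [S cS dS] mf mg ch mD; move: (mD).
apply: (@measurability _ _ aT (borelType Y) D _ (@open Y)) => // _ [V oV <-].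
pose Q := (S `*` S) `*` [set: nat].
pose rad (q : (X * X) * nat) : R := q.2.+1%:R^-1.
pose box (q : (X * X) * nat) := ball q.1.1 (rad q) `*` ball q.1.2 (rad q).
pose Q' := Q `&` [set q | box q `<=` h @^-1` V].
have cQ' : countable Q'.
  apply: (@sub_countable _ _ _ Q); first exact: subset_card_le (@subIsetl _ _ _).
  by apply: countableX; first exact: countableX.
have -> : D `&` (fun t => h (f t, g t)) @^-1` V =
    \bigcup_(q in Q') ((D `&` f @^-1` ball q.1.1 (rad q)) `&`
                       (D `&` g @^-1` ball q.1.2 (rad q))).
  apply/seteqP; split => t; last first.
    by move=> [q [_ qV] [[Dt ft] [_ gt]]]; split=> //; exact: (qV (_, _)).
  move=> [Dt Vt].
  have : nbhs (f t, g t) (h @^-1` V).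
    by apply: ch; exact: open_nbhs_nbhs.
  move=> /nbhs_ballP[e /= e0 eV].
  (* Any ball of radius below [e / 2] containing [f t] lies in the ball of radius [e] around [f t];
     likewise for [g t]. *)
  have [n ne] : exists n : nat, n.+1%:R^-1 < e / 2.
    have e2 : 0 < e / 2 by rewrite divr_gt0.
    by have [n _ /(_ n (leqnn n))] := near_infty_natSinv_lt (PosNum e2); exists n.
  have n0 : 0 < n.+1%:R^-1 :> R by rewrite invr_gt0.
  have dense_ball z : exists2 y, S y & ball y n.+1%:R^-1 z.
    have [||y [zy Sy]] := dS (ball z n.+1%:R^-1).
    - by exists z; exact: ballxx.
    - exact: ball_open.
    - by exists y => //; exact: ball_sym.
  have [y Sy yf] := dense_ball (f t); have [z Sz zg] := dense_ball (g t).
  exists ((y, z), n) => //; split => // -[y' z'] [/= yy' zz'].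
  have in_e (a b c : X) : ball a n.+1%:R^-1 b -> ball a n.+1%:R^-1 c -> ball b e c.
    move=> /ball_sym ab ac; apply: (@le_ball _ _ _ (n.+1%:R^-1 + n.+1%:R^-1)).
      by rewrite (splitr e) lerD// ltW.
    exact: ball_triangle ab ac.
  by apply: eV; split => /=; [apply: in_e yf yy'|apply: in_e zg zz'].
rewrite bigcup_set_type; apply: countable_bigcupT_measurable => [|q].
  by rewrite /countable (card_le_eql (card_setT Q')).
apply: measurableI; [apply: mf|apply: mg] => //; apply: sub_sigma_algebra;
  exact: ball_open.
Qed.

(** Compactness reduces the claim to [s] near a fixed [t] and large [n]. There [F (u s)] and
    [F (u_ n s)] are both within [d / 2] of [F (u t)], through which the estimate passes. *)
Lemma hausdorff_continuous_unif_close {R : realType} {H : normedModType R}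
    (K : set R) (F : H -> set H) (u_ : nat -> R -> H) (u : R -> H) (d : R) :
  compact K -> hausdorff_continuous F -> {within K, continuous u} ->
  {uniform K, u_ @ \oo --> u} -> 0 < d ->
  \forall n \near \oo, forall t, K t ->
    forall a, F (u t) a -> exists2 b, F (u_ n t) b & `|a - b| < d.
Proof.
move=> + contF cu u_u d0.
move=> /compact_near_coveringP/near_covering_withinP; apply=> t Kt.
have d2 : 0 < d / 2 by rewrite divr_gt0.
have /nbhs_ballP[e /= e0 Fe] := contF (u t) _ d2.
have e2 : 0 < e / 2 by rewrite divr_gt0.
have ut : \forall s \near t, K s -> ball (u t) (e / 2) (u s).
  have /cvgr_dist_lt /(_ _ e2) := cu t; rewrite /nbhs/= -nbhs_subspace_in//.
  rewrite near_withinE => uT.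
  by apply: filterS uT => s us Ks; rewrite -ball_normE; exact: us.
have un : \forall n \near \oo, forall s, K s -> ball (u s) (e / 2) (u_ n s).
  suff /u_u : nbhs (u : {uniform` K -> H})
    [set h | forall s, K s -> ball (u s) (e / 2) (h s)] by [].
  apply/uniform_nbhs.
  exists [set z | ball z.1 (e / 2) z.2].
  by split; [exact: (@entourage_ball _ H (PosNum e2))|].
near=> s n => /= Ks a Fa.
have us : ball (u t) (e / 2) (u s) by apply: (near ut s).
have uns : ball (u s) (e / 2) (u_ n s) by apply: (near un n).
have [|c Fc ca] := hausdorff_dist_ltr _ _ _ _ (Fe (u s) _) Fa.
  by apply: le_ball us; lra.
have [|b Fb cb] := hausdorff_dist_ltl _ _ _ _ (Fe (u_ n s) _) Fc.
  by rewrite (splitr e); exact: ball_triangle us uns.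
exists b => //; have := ler_distD c a b; rewrite (distrC a c); lra.
Unshelve. all: by end_near. Qed.

(** * Lebesgue measurability and the norm estimate *)

Lemma measurable_lebesgueTypeR {R : realType} (A : set R) :
  measurable (A : set (measurableTypeR R)) ->
  measurable (A : set (lebesgueTypeR R)).
Proof. by move=> mA; exact: sub_caratheodory. Qed.

Lemma within_continuous_measurable {R : realType} {X : ptopologicalType}
    (D : set R) (g : R -> X) : measurable (D : set (measurableTypeR R)) ->
  {within D, continuous g} ->
  measurable_fun (D : set (lebesgueTypeR R)) (g : lebesgueTypeR R -> borelType X).
Proof.
move=> mD cg mD'; move: (mD').
apply: (@measurability _ _ (lebesgueTypeR R) (borelType X) D _ (@open X)) => //.
move=> _ [V oV <-]; apply: measurable_lebesgueTypeR.
apply: measurable_realfun.open_measurable_subspace => //.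
by move/continuousP : cg; exact.
Qed.

Lemma Lnorm2_restrict_le {d} {aT : measurableType d} {R : realType}
    (mu : {measure set aT -> \bar R}) (D : set aT) (h : aT -> R) (c m : R) :
  measurable D -> mu D = m%:E -> 0 <= c -> (forall t, 0 <= h t) ->
  measurable_fun D h -> {ae mu, forall t, D t -> h t <= c} ->
  ('N[mu]_2%:E[(EFin \o h) \_ D] <= (c * Num.sqrt m)%:E)%E.
Proof.
move=> mD muD c0 h0 mh hc.
have m0 : 0 <= m by rewrite -lee_fin -muD.
have c20 : 0 <= c ^+ 2 * m by rewrite mulr_ge0// sqr_ge0.
have int_le : (\int[mu]_(t in D) (h t ^+ 2)%:E <= (c ^+ 2 * m)%:E)%E.
  rewrite EFinM -muD -integral_cst//; apply: ae_ge0_le_integral => //.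
  - by move=> t _; rewrite lee_fin sqr_ge0.
  - by apply/measurable_realfun.measurable_EFinP; exact: measurable_realfun.measurable_funX.
  - by move=> t _; rewrite lee_fin sqr_ge0.
  - by apply: filterS hc => t hc Dt; rewrite lee_fin ler_pXn2r ?nnegrE ?hc.
have -> : (c * Num.sqrt m)%:E = ((c ^+ 2 * m)%:E `^ 2^-1)%E.
  by rewrite poweR_EFin powR12_sqrt// sqrtrM ?sqr_ge0// sqrtr_sqr ger0_norm.
rewrite unlock; have -> : (\int[mu]_t `|((EFin \o h) \_ D) t| `^ 2 =
    \int[mu]_(t in D) (h t ^+ 2)%:E)%E.
  rewrite [RHS]integral_mkcond; apply: eq_integral => t _; rewrite !patchE.
  (* Outside [D] the restriction takes the default [point], which is 0 here. *)
  case: ifP => _; last first.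
    by rewrite (_ : point = 0%E)// abse0; apply: poweR0r; rewrite pnatr_eq0.
  by rewrite /= ger0_norm// powR_mulrn.
apply: gt0_ler_poweR => //; rewrite in_itv/= ?leey ?andbT//.
by apply: integral_ge0 => t _; rewrite lee_fin sqr_ge0.
Qed.

(** The usual sigma-algebra on [R] is generated by open intervals, which are open sets. *)
Lemma measurable_fun_borelType_real {d} {aT : measurableType d} {R : realType}
    (D : set aT) (g : aT -> R) :
  measurable_fun D (g : aT -> borelType R) -> measurable_fun D g.
Proof.
move=> mg mD; move: (mD).
apply: (measurability _ (measurable_realfun.RGenOpens.measurableE R)).
move=> _ [_ [x [y ->]] <-]; apply: mg => //.
by apply: sub_sigma_algebra; exact: itv_open.
Qed.

Theorem theorem3p3p1 (R : realType) (H : completeNormedModType R)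
    (dot : {dot H for (@idfun R)}) (dotH : induces_norm dot)
    (sepH : separable H) (T : R) (T0 : 0 < T) (F : H -> set H)
    (bccF : bcc F) (contF : hausdorff_continuous F)
    (u_ : nat -> R -> H) (u : R -> H)
    (cu_ : forall n, {within `[0, T], continuous (u_ n)})
    (cu : {within `[0, T], continuous u})
    (u_u : {uniform `[0, T], u_ @ \oo --> u}) :
  forall eps : R, 0 < eps ->
  exists n0 : nat, forall n, (n0 <= n)%N ->
  forall f, Sel T F u f ->
  exists2 fn, Sel T F (u_ n) fn &
    (L2norm T (fun t => fn t - f t)%R <= eps%:E)%E.
Proof.
move=> eps eps0.
have sT0 : 0 < Num.sqrt T by rewrite sqrtr_gt0.
(* A function bounded by [d] on [[0, T]] has norm at most [d * Num.sqrt T], that is [eps]. *)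
pose d := eps / Num.sqrt T.
have d0 : 0 < d by rewrite divr_gt0.
have [n0 _ close] := hausdorff_continuous_unif_close _ _ _ _ _
  (@segment_compact R 0 T) contF cu u_u d0.
exists n0 => n n0n f [mf fF].
have projF v x := let: And4 Fn _ Fcl Fcv := bccF v in
  projP dotH _ x Fn Fcl Fcv.
have mI : measurable (`[0, T] : set (lebesgueTypeR R)).
  by apply: measurable_lebesgueTypeR; exact: measurable_itv.
have mu_n : measurable_fun (`[0, T] : set (lebesgueTypeR R))
    (u_ n : lebesgueTypeR R -> borelType H).
  by apply: within_continuous_measurable => //; exact: measurable_itv.
pose fn t := proj (F (u_ n t)) (f t).
have mfn : measurable_fun (`[0, T] : set (lebesgueTypeR R))
    (fn : lebesgueTypeR R -> borelType H).
  have cproj := proj_continuous dotH _ bccF contF.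
  exact: (measurable_comp2 _ _ _ _ sepH mu_n mf cproj).
exists fn.
  by split=> //; apply: aeW => t _; exact: (projF _ _).1.
rewrite -[eps](@divfK _ (Num.sqrt T)) ?gt_eqF//.
apply: Lnorm2_restrict_le => //; rewrite -/d.
- (* both measures are restrictions of the same outer measure *)
  change (lebesgue_measure (`[0, T]%classic : set R) = T%:E).
  by rewrite lebesgue_measure_itv/= lte_fin T0 sube0.
- exact: ltW.
- pose h := fun z : H * H => `|z.1 - z.2|.
  have ch : continuous h.
    move=> z; apply: (@continuous_comp _ _ _ (fun z : H * H => z.1 - z.2) Num.norm).
      by apply: cvgB; [exact: cvg_fst|exact: cvg_snd].
    exact: norm_continuous.
  apply: measurable_fun_borelType_real.
  exact: (measurable_comp2 _ _ _ _ sepH mfn mf ch).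
(* The bound can fail only on the null set where [f t] is outside [F (u t)]. Elsewhere some [b] in
   [F (u_ n t)] is within [d] of [f t], and the projection is at least as close. *)
apply: negligibleS fF => t; apply: contra_not => fF /=; rewrite in_itv/= => It.
have [b Fb fb] := close n n0n t It _ (fF It).
by rewrite distrC; exact: le_trans ((projF _ _).2 b Fb) (ltW fb).
Qed.
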